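(* Let $\mathcal{G}$ be an integer monotonicity-constraint transition system (MCS). If there is a ranking structure for $\mathcal{G}$, then $\mathcal{G}$ terminates, i.e. $\mathcal{G}$ has no infinite run.
   Context: An MCS $\mathcal{G}$ is a finite set of transition rules over a finite set of program points, each program point $p$ having a fixed arity $n$. A program state is $p(\bar x)$ with $\bar x\in\mathbb{Z}^n$; $St$ denotes the set of states. A transition rule has the form $p(\bar x) \,:\!-\, \pi;\, q(\bar y)$ where $\bar x,\bar y$ are tuples of distinct variables of the arities of $p,q$ and $\pi$ (a monotonicity constraint) is a conjunction of constraints $a>b$ or $a\ge b$ with $a,b\in\bar x\cup\bar y$. A run is a finite or infinite sequence of states $p_0(\bar x_0)\xrightarrow{\pi_0}p_1(\bar x_1)\xrightarrow{\pi_1}\cdots$ such that each consecutive pair corresponds to a rule $p_i(\bar x)\,:\!-\,\pi_i;\,p_{i+1}(\bar y)$ of $\mathcal{G}$ with $\pi_i$ satisfied when $\bar x,\bar y$ are replaced by $\bar x_i,\bar x_{i+1}$. $\mathcal{G}$ terminates if it has no infinite run. Let $(\mathcal D,\succsim)$ be a quasi-order (transitive, reflexive) with strict part $x\succ y \iff x\succsim y\wedge y\not\succsim x$, and let $\mathcal D_+\subseteq\mathcal D$ be well-founded (no infinite $\succ$-chain). For $\Phi:St\to\mathcal D$ and a set of rules $\mathcal{H}$, a rule $g\in\mathcal H$ is a $\Phi$-anchor for $\mathcal H$ if for every run $p_0(\bar x_0)\xrightarrow{\pi_0}\cdots\xrightarrow{\pi_k}p_{k+1}(\bar x_{k+1})$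 of $\mathcal H$ whose first step and last step ($p_k(\bar x_k)\to p_{k+1}(\bar x_{k+1})$) both correspond to $g$, we have $\Phi(p_i(\bar x_i))\succsim\Phi(p_{i+1}(\bar x_{i+1}))$ for all $0\le i\le k$ with at least one of these strict, and $\Phi(p_i(\bar x_i))\in\mathcal D_+$ for some $0\le i\le k$. A tuple $\langle\Phi_1,\dots,\Phi_m\rangle$ of functions $St\to\mathcal D$ is a ranking structure for $\mathcal G$ if, defining $\mathcal G_1$ as the set of $g\in\mathcal G$ that are $\Phi_1$-anchors for $\mathcal G$ and, for $2\le i\le m$, $\mathcal G_i$ as the set of $g\in\mathcal G\setminus(\mathcal G_1\cup\dots\cup\mathcal G_{i-1})$ that are $\Phi_i$-anchors for $\mathcal G\setminus(\mathcal G_1\cup\dots\cup\mathcal G_{i-1})$, we have $\mathcal G_1\cup\dots\cup\mathcal G_m=\mathcal G$. *)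

(* Defs.v *)
From mathcomp Require Import all_boot all_order all_algebra.
From mathcomp Require Import boolp classical_sets functions cardinality.
From Stdlib Require Import Relation_Definitions.

Set Implicit Arguments.
Unset Strict Implicit.
Unset Printing Implicit Defensive.

Local Open Scope classical_set_scope.
Local Open Scope ring_scope.

Section MCS.
Variables (P : finType) (arity : P -> nat).

(* [State x] is the state p(x); the program point p is inferred from x. *)
Record state : Type := State { point : P; values : (arity point).-tuple int }.

(* The variables of a rule p(x) :- pi; q(y) are referred to by their position:
   [inl i] is the i-th variable of x, [inr j] the j-th variable of y. *)
Definition variable (p q : P) : Type := ('I_(arity p) + 'I_(arity q))%type.

Inductive atom (p q : P) : Type :=
  | Gt of variable p q & variable p q
  | Ge of variable p q & variable p q.

(* A monotonicity constraint is the conjunction of a list of atoms. *)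
Record rule : Type := Rule {
  source : P;
  target : P;
  constraint : seq (atom source target)
}.

Section Satisfaction.
Variables (p q : P) (x : (arity p).-tuple int) (y : (arity q).-tuple int).

Definition value (v : variable p q) : int :=
  match v with inl i => tnth x i | inr j => tnth y j end.

Definition sat_atom (a : atom p q) : bool :=
  match a with
  | Gt a b => value a > value b
  | Ge a b => value a >= value b
  end.

Definition sat (pi : seq (atom p q)) : bool := all sat_atom pi.

End Satisfaction.

Definition step (g : rule) (s t : state) : Prop :=
  exists x y, [/\ s = @State (source g) x, t = @State (target g) y
                & sat x y (constraint g)].

(* A run is given by its states [s i] and the rules [r i] labelling its steps.
   A run of n steps only involves s 0, ..., s n and r 0, ..., r (n-1); the
   other values are irrelevant. *)
Definition finite_run (H : set rule) (n : nat)
    (s : nat -> state) (r : nat -> rule) : Prop :=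
  forall i, (i < n)%N -> H (r i) /\ step (r i) (s i) (s i.+1).

Definition infinite_run (H : set rule)
    (s : nat -> state) (r : nat -> rule) : Prop :=
  forall i, H (r i) /\ step (r i) (s i) (s i.+1).

Definition terminates (G : set rule) : Prop :=
  ~ exists s r, infinite_run G s r.

Section Ranking.
Variables (D : Type) (geD : relation D) (Dplus : set D).

Definition gtD (x y : D) : Prop := geD x y /\ ~ geD y x.

Definition no_infinite_chain (A : set D) : Prop :=
  ~ exists f : nat -> D, forall i, A (f i) /\ gtD (f i) (f i.+1).

Definition anchor (Phi : state -> D) (H : set rule) (g : rule) : Prop :=
  H g /\
  forall (k : nat) (s : nat -> state) (r : nat -> rule),
    finite_run H k.+1 s r -> r 0%N = g -> r k = g ->
    [/\ forall i, (i <= k)%N -> geD (Phi (s i)) (Phi (s i.+1)),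
        exists2 i, (i <= k)%N & gtD (Phi (s i)) (Phi (s i.+1))
      & exists2 i, (i <= k)%N & Dplus (Phi (s i))].

(* The equations in the first clause determine the sets [Gs i] uniquely, by
   strong induction on i. *)
Definition ranking_structure (G : set rule) (m : nat)
    (Phi : 'I_m -> state -> D) : Prop :=
  (0 < m)%N /\
  exists Gs : 'I_m -> set rule,
    (forall i : 'I_m,
       let H := G `\` \bigcup_(j in [set j : 'I_m | (j < i)%N]) Gs j in
       Gs i = [set g | anchor (Phi i) H g]) /\
    \bigcup_i Gs i = G.

End Ranking.
End MCS.

(* Main.v *)
(** Along an infinite run, every rule of [Gs i] occurs only finitely often, by
    strong induction on [i]: past some point no rule of any [Gs j] with [j < i]
    occurs any more.  If a [Phi i]-anchor [g] of the remaining rules occurred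
    infinitely often, its anchor property would apply between any two of its
    occurrences, so that [Phi i] never increases; applied to a single
    occurrence (a run of length one) it makes that step a strict decrease
    starting in [Dplus].  The successive occurrences of [g] thus give an
    infinite chain in [Dplus].  As there are finitely many rules, the run would
    eventually use none of them. *)
Require Import Defs.
From mathcomp Require Import all_boot all_order all_algebra.
From mathcomp Require Import boolp classical_sets functions cardinality.
From Stdlib Require Import Relation_Definitions.

Local Open Scope classical_set_scope.

Definition eventually_absent {T : Type} (r : nat -> T) (x : T) : Prop :=
  exists N, forall n, (N <= n)%N -> r n <> x.

Lemma eventually_absent_finite (T : Type) (r : nat -> T) (A : set T) :
  finite_set A -> (forall x, A x -> eventually_absent r x) ->
  exists N, forall n, (N <= n)%N -> ~ A (r n).
Proof.
move=> finA absA.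
have /choice[N absN] : forall x, exists N, A x ->
    forall n, (N <= n)%N -> r n <> x.
  move=> x; have [/absA[N absN]|nAx] := pselect (A x); first by exists N.
  by exists 0%N.
have /finite_seqP[s NA] := finite_image N finA.
(* Finiteness of [A] allows the maximum of all the individual thresholds [N x]. *)
exists (\max_(k <- s) k)%N => n le_n /[dup] Arn /absN/(_ n); apply => //.
apply: leq_trans le_n; apply: (@leq_bigmax_seq _ _ xpredT id) => //.
have : (N @` A) (N (r n)) by exists (r n).
by rewrite NA.
Qed.

Lemma not_eventually_absent (T : Type) (r : nat -> T) (x : T) (n0 : nat) :
  ~ eventually_absent r x ->
  exists a : nat -> nat,
    [/\ (n0 <= a 0)%N, forall n, (a n < a n.+1)%N & forall n, r (a n) = x].
Proof.
move=> often.
have /choice[next nextP] : forall N, exists n, (N <= n)%N /\ r n = x.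
  move=> N; apply: contrapT => none; apply: often; exists N => n le_Nn rn.
  by apply: none; exists n.
(* [next N] is an occurrence at or after [N]; restarting the search at the successor of each
   occurrence makes [a] strictly increasing. *)
exists (fun n => iter n (next \o succn) (next n0)); split.
- by case: (nextP n0).
- by move=> n /=; case: (nextP (iter n (next \o succn) (next n0)).+1).
- by case=> [|n] /=; apply: (nextP _).2.
Qed.

Lemma preorder_chain (D : Type) (R : relation D) (f : nat -> D) (m n : nat) :
  preorder D R -> (m <= n)%N ->
  (forall i, (m <= i < n)%N -> R (f i) (f i.+1)) -> R (f m) (f n).
Proof.
move=> [Rrefl Rtrans]; elim: n => [|n IHn].
  by rewrite leqn0 => /eqP ->.
rewrite leq_eqVlt => /predU1P[-> //|le_mn] Rf.
apply: (Rtrans _ (f n)); last by apply: Rf; rewrite -ltnS le_mn /=.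
apply: IHn => // i /andP[le_mi lt_in].
by apply: Rf; rewrite le_mi ltnS ltnW.
Qed.

Section Anchors.
Context {P : finType} {arity : P -> nat} {D : Type}.
Context {geD : relation D} {Dplus : set D}.
Hypotheses (geD_preorder : preorder D geD).
Hypotheses (Dplus_wf : no_infinite_chain geD Dplus).

Lemma gtD_geD_trans (x y z : D) : gtD geD x y -> geD y z -> gtD geD x z.
Proof.
case: geD_preorder => _ trans [xy nyx] yz; split; first exact: trans yz.
by move=> zx; apply: nyx; apply: trans zx.
Qed.

(** Anchors only speak of runs indexed from 0, so a segment of the tail is shifted. *)
Lemma infinite_run_finite_run {H : set (rule arity)} {s : nat -> state arity}
    {r : nat -> rule arity} (m n : nat) :
  (forall i, (m <= i)%N -> H (r i) /\ step (r i) (s i) (s i.+1)) ->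
  finite_run H n (fun i => s (m + i)%N) (fun i => r (m + i)%N).
Proof. by move=> run i _; rewrite addnS; apply: run; apply: leq_addr. Qed.

Lemma anchor_eventually_absent (Phi : state arity -> D)
    (H : set (rule arity)) (g : rule arity)
    (s : nat -> state arity) (r : nat -> rule arity) (n0 : nat) :
  (forall i, (n0 <= i)%N -> H (r i) /\ step (r i) (s i) (s i.+1)) ->
  anchor geD Dplus Phi H g -> eventually_absent r g.
Proof.
move=> run [_ anc]; apply: contrapT => /(@not_eventually_absent _ _ _ n0).
move=> [a [a0 lt_a ra]].
have le_a n : (n0 <= a n)%N.
  by elim: n => // n IHn; apply: leq_trans IHn (ltnW (lt_a n)).
have run_from n k := infinite_run_finite_run (a n) k
  (fun i le_i => run i (leq_trans (le_a n) le_i)).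
apply: Dplus_wf; exists (fun n => Phi (s (a n))) => n.
(* Case [k = 0]: the step at [a n] is both first and last, so the two existential indices must be
   0. *)
have [_ [i + dec] [j + pos]] :=
  anc 0%N _ _ (run_from n 1%N)
      (etrans (f_equal r (addn0 _)) (ra n))
      (etrans (f_equal r (addn0 _)) (ra n)).
rewrite !leqn0 => /eqP i0 /eqP j0; subst i j; split.
  by rewrite addn0 in pos.
rewrite addn1 addn0 in dec; apply: gtD_geD_trans dec _.
apply: (@preorder_chain _ _ (Phi \o s)) => // i /andP[/ltnW le_i lt_i].
have last_g : r (a n + (a n.+1 - a n))%N = g by rewrite subnKC ?ra // ltnW.
(* The segment includes the step at [a n.+1], so that it begins and ends with [g]. *)
have [/(_ (i - a n)%N) + _ _] :=
  anc (a n.+1 - a n)%N _ _ (run_from n _)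
      (etrans (f_equal r (addn0 _)) (ra n)) last_g.
by rewrite addnS subnKC //; apply; rewrite leq_sub2r // ltnW.
Qed.

Lemma ranking_structure_eventually_absent (G : set (rule arity)) (m : nat)
    (Phi : 'I_m -> state arity -> D)
    (s : nat -> state arity) (r : nat -> rule arity) :
  finite_set G -> ranking_structure geD Dplus G Phi -> infinite_run G s r ->
  forall g, G g -> eventually_absent r g.
Proof.
move=> finG [_ [Gs [GsE GsG]]] run g; rewrite -{1}GsG => -[i _].
have [k] := ubnP (val i); elim: k i g => // k IHk i g lt_ik Gsg.
pose L := \bigcup_(j in [set j : 'I_m | (j < i)%N]) Gs j.
have LG : L `<=` G by rewrite -GsG => h [j _ Gjh]; exists j.
(* From [n0] on, the run stays in [G] minus [L], the very set for which [g] is a [Phi i]-anchor. *)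
have [|n0 absL] := @eventually_absent_finite _ r L (sub_finite_set LG finG).
  by move=> h [j lt_ji]; apply: IHk; apply: leq_trans lt_ji _.
move: Gsg; rewrite GsE; apply: (@anchor_eventually_absent _ _ _ s _ n0) => l.
by move=> /absL nL; have [Grl stepl] := run l.
Qed.

End Anchors.

Theorem theorem1
  (P : finType) (arity : P -> nat)
  (G : set (rule arity)) (G_finite : finite_set G)
  (D : Type) (geD : relation D) (geD_preorder : preorder D geD)
  (Dplus : set D) (Dplus_wf : no_infinite_chain geD Dplus) :
  (exists (m : nat) (Phi : 'I_m -> state arity -> D),
     ranking_structure geD Dplus G Phi) ->
  terminates G.
Proof.
move=> [m [Phi rank]] [s [r run]].
(* The contradiction is at step [N], whose rule [r N] still lies in [G]. *)
have [N absG] := @eventually_absent_finite _ r G G_finite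
  (ranking_structure_eventually_absent geD_preorder Dplus_wf
     G m Phi s r G_finite rank run).
by apply: (absG N) => //; case: (run N).
Qed.
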